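(* Let $M$ be a matroid with ground set $E$, let $A$ be a basis of $M$, and for $t\in[k]$ let $\psi_t\colon E\to\Gamma_t$ be a map to an abelian group $\Gamma_t$ and $f_t\in\Gamma_t$. Assume $M$ has at least one basis $B'$ with $\psi_t(B')\ne f_t$ for all $t\in[k]$. Then: (i) if $M$ is SIBO, $M$ has a basis $B$ with $\psi_t(B)\ne f_t$ for all $t\in[k]$ and $|A\setminus B|\le\lfloor (e-1/2)k!\rfloor-1$ (with $e$ Euler's number); (ii) if $k=2$, $M$ has a basis $B$ with $\psi_1(B)\ne f_1$, $\psi_2(B)\ne f_2$, and $|A\setminus B|\le 3$.
   Context: For $X\subseteq E$, $\psi_t(X)\coloneqq\sum_{e\in X}\psi_t(e)$. A rank-$r$ matroid is SIBO (subsequence-interchangeably base orderable) if every pair of bases $A,B$ admits orderings $a_1,\dots,a_r$ of $A$ and $b_1,\dots,b_r$ of $B$ such that $\{b_1,\dots,b_{i-1},a_i,\dots,a_j,b_{j+1},\dots,b_r\}$ is a basis for every $1\le i\le j\le r$. *)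

(* Defs.v *)
From mathcomp Require Import all_boot.

Set Implicit Arguments.
Unset Strict Implicit.
Unset Printing Implicit Defensive.

(* Finite matroids given by their bases; the ground set is the whole finType. *)
Record matroid (E : finType) := Matroid {
  bases : {set {set E}};
  bases_nonempty : bases != set0;
  bases_exchange : forall B1 B2 x,
    B1 \in bases -> B2 \in bases -> x \in B1 :\: B2 ->
    exists2 y, y \in B2 :\: B1 & (y |: (B1 :\ x)) \in bases
}.

(* All bases have the same cardinality, so the maximum is attained by each. *)
Definition rank (E : finType) (M : matroid E) : nat :=
  \max_(B in bases M) #|B|.

Definition ordering (E : finType) (r : nat) (X : {set E}) (a : 'I_r -> E) : Prop :=
  injective a /\ [set a l | l in 'I_r] = X.

(* Indices are shifted by one: i and j range over 0, ..., r - 1. *)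
Definition SIBO (E : finType) (M : matroid E) : Prop :=
  forall A B, A \in bases M -> B \in bases M ->
  exists a b : 'I_(rank M) -> E,
    [/\ ordering A a, ordering B b &
        forall i j : 'I_(rank M), i <= j ->
          [set b l | l in 'I_(rank M) & l < i]
          :|: [set a l | l in 'I_(rank M) & i <= l <= j]
          :|: [set b l | l in 'I_(rank M) & j < l] \in bases M].

(* Main.v *)
Require Import Defs.
From mathcomp Require Import all_boot all_order all_algebra.
From mathcomp Require Import reals sequences exp.
From mathcomp Require Import ring lra.

Set Implicit Arguments.
Unset Strict Implicit.
Unset Printing Implicit Defensive.

Import Order.TTheory GRing.Theory Num.Theory.

(** Let B be an avoiding basis minimizing |A \ B|, and suppose that exchanging
    b_i, ..., b_j for a_i, ..., a_j in B gives a basis for all i <= j.  This basis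
    is closer to A, so for some t its psi_t-label is f_t: the differences
    psi_t(a_l) - psi_t(b_l), i <= l <= j, sum to d_t := f_t - psi_t(B) <> 0.
    Colour the pair (i, j + 1) with t.  In terms of prefix sums s_t, colour t
    means s_t(j + 1) = s_t(i) + d_t, so the pairs inside the colour-t neighbourhood
    of a vertex do not have colour t, and induction on the number of colours
    bounds the number of vertices as in the Ramsey bound for triangles.  For two
    colours the group structure rules out the pentagon colouring of K_5; starting
    the recursion from there replaces e k! by (e - 1/2) k!.

    For (ii), if |A \ B| >= 4 then some basis A' with A :&: B \subset A' has
    |A' \ B| = 4, and any two such bases of any matroid have orderings as
    above.  This last fact is finite: symmetric exchanges produce suitable initial
    bases, and a refutation by unit propagation with nine case splits does the
    rest. *)

(** * Bases of a matroid *)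

Section MatroidBases.
Variables (E : finType) (M : matroid E).
Implicit Types A B D Y : {set E}.

Lemma leq_card_bases A B : A \in bases M -> B \in bases M -> #|A| <= #|B|.
Proof.
move: {2}#|A :\: B| (erefl #|A :\: B|) => n.
elim: n A => [|n IH] A cAB bA bB.
  by apply: subset_leq_card; rewrite -setD_eq0 -cards_eq0 cAB.
have /set0Pn[x xAB] : A :\: B != set0 by rewrite -cards_eq0 cAB.
have [y yBA bA'] := bases_exchange bA bB xAB.
move: xAB yBA; rewrite !inE => /andP[xB xA] /andP[yA yB].
have cA' : #|y |: (A :\ x)| = #|A|.
  by rewrite cardsU1 !inE (negbTE yA) andbF (cardsD1 x A) xA.
rewrite -cA'; apply: IH => //.
have -> : (y |: A :\ x) :\: B = (A :\: B) :\ x.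
  apply/setP=> z; rewrite !inE; case: (z =P y) => [->|_] //=.
    by rewrite yB (negbTE yA) !andbF.
  by rewrite andbCA.
by move: cAB; rewrite (cardsD1 x) !inE xB xA => -[].
Qed.

Lemma card_bases A B : A \in bases M -> B \in bases M -> #|A| = #|B|.
Proof. by move=> bA bB; apply/eqP; rewrite eqn_leq !leq_card_bases. Qed.

Lemma card_basesD A B : A \in bases M -> B \in bases M -> #|A :\: B| = #|B :\: A|.
Proof.
move=> bA bB; have := card_bases bA bB.
by rewrite -(cardsID B A) -(cardsID A B) setIC => /addnI.
Qed.

Lemma card_basis_rank B : B \in bases M -> #|B| = rank M.
Proof.
move=> bB; apply/eqP; rewrite eqn_leq leq_bigmax_cond //=.
by apply/bigmax_leqP=> A bA; exact: leq_card_bases.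
Qed.

(** Exchanging an element of [D] outside [Y :|: B] for one of [B] shrinks [D :\: (Y :|: B)] and
    keeps [Y]. *)
Lemma basis_extension Y D B : D \in bases M -> B \in bases M -> Y \subset D ->
  exists D', [/\ D' \in bases M, Y \subset D' & D' \subset Y :|: B].
Proof.
move: {2}#|D :\: (Y :|: B)| (erefl #|D :\: (Y :|: B)|) => n.
elim: n D => [|n IH] D cD bD bB sYD.
  by exists D; split=> //; rewrite -setD_eq0 -cards_eq0 cD.
have /set0Pn[x] : D :\: (Y :|: B) != set0 by rewrite -cards_eq0 cD.
rewrite !inE negb_or => /andP[/andP[xY xB] xD].
have [|y yBD bD'] := bases_exchange (x := x) bD bB; first by rewrite inE xB.
move: yBD; rewrite inE => /andP[yD yB].
apply: (IH (y |: D :\ x)) => //; last first.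
  apply/subsetP=> z zY; rewrite !inE (subsetP sYD) // andbT.
  by rewrite (memPn xY) ?orbT.
move: cD; rewrite (cardsD1 x) !inE negb_or xY xB xD => -[<-].
apply: eq_card => z; rewrite !inE; case: (z =P y) => [->|_] //=.
  by rewrite yB (negbTE yD) orbT !andbF.
by rewrite andbCA.
Qed.

(* Y is the fundamental circuit of x with respect to B, without x. *)
Lemma symmetric_exchange A B x : A \in bases M -> B \in bases M ->
    x \in A :\: B ->
  exists y, [/\ y \in B :\: A, (y |: A :\ x) \in bases M
              & (x |: B :\ y) \in bases M].
Proof.
move=> bA bB; rewrite inE => /andP[xB xA].
pose Y := [set y in B | (x |: B :\ y) \in bases M].
have sYB : Y \subset B by apply/subsetP=> y; rewrite inE => /andP[].
(* A basis containing [Y] and [x] could be filled up from [B] to a basis [x |: B :\ z]; then [z] is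
   in [Y] but missing from that basis. *)
have depY D : D \in bases M -> Y \subset D -> x \notin D.
  move=> bD sYD; apply/negP => xD.
  have [|D' [bD' sD' D'B]] := @basis_extension (x |: Y) D B bD bB.
    by rewrite subUset sub1set xD.
  have xD' : x \in D' by rewrite (subsetP sD') // setU11.
  have D'xB z : z \in D' -> z != x -> z \in B.
    by move=> /(subsetP D'B); rewrite !inE => /orP[/orP[->|/andP[]]|].
  have [sBD'|nBD'] := boolP (B \subset D').
    have: #|x |: B| <= #|D'| by rewrite subset_leq_card // subUset sub1set xD'.
    by rewrite cardsU1 xB (card_bases bD' bB) ltnn.
  have [z zB zD'] := subsetPn nBD'.
  have eD' : D' = x |: B :\ z.
    apply/eqP; rewrite eqEcard; apply/andP; split; last first.
      rewrite (card_bases bD' bB) cardsU1 !inE (negbTE xB) andbF.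
      by rewrite (cardsD1 z B) zB.
    apply/subsetP=> w wD'; rewrite !inE; case: eqVneq => //= wx.
    by rewrite (D'xB _ wD' wx) andbT; apply: contraNneq zD' => <-.
  have: z \in Y by rewrite inE zB -eD'.
  by move=> zY; case/negP: zD'; rewrite (subsetP sD') // in_setU zY orbT.
(* As [D] is contained in [Y :|: A], whatever replaces [x] in [A] comes from [Y], which makes the
   exchange symmetric. *)
have [D [bD sYD sDYA]] := basis_extension bB bA sYB.
have xD := depY D bD sYD.
have [|y] := bases_exchange (x := x) bA bD; first by rewrite inE xD.
rewrite inE => /andP[yA yD] bA'.
have: y \in Y by have:= subsetP sDYA y yD; rewrite inE (negbTE yA) orbF.
by rewrite inE => /andP[yB bB']; exists y; rewrite inE yA.
Qed.

(** [B] stays fixed while [D] moves towards it, so each step yields both the next basis of the chain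
    and a basis one exchange away from [B]. *)
Lemma symmetric_exchange_chain D B (s : seq E) : D \in bases M -> B \in bases M ->
    uniq s -> {subset s <= D :\: B} ->
  exists t, [/\ size t = size s, uniq t, {subset t <= B :\: D},
    all (fun xy => (xy.1 |: B :\ xy.2) \in bases M) (zip s t) &
    forall i, foldl (fun D xy => xy.2 |: D :\ xy.1) D (take i (zip s t))
              \in bases M].
Proof.
elim: s D => [|x s IH] D bD bB; first by exists [::].
move=> /andP[xs us] sDB.
have xDB : x \in D :\: B by apply: sDB; rewrite mem_head.
have [y [yBD bD' bB']] := symmetric_exchange bD bB xDB.
move: xDB yBD; rewrite !inE => /andP[xB xD] /andP[yD yB].
have [|t [st ut tB allt chain]] := IH (y |: D :\ x) bD' bB us.
  move=> z zs; have := sDB z; rewrite !inE zs orbT => /(_ isT)/andP[-> ->].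
  by rewrite (memPn xs) ?orbT.
exists (y :: t); split.
- by rewrite /= st.
- by rewrite /= ut andbT; apply/negP=> /tB; rewrite !inE eqxx.
- move=> z; rewrite !inE => /orP[/eqP->|/tB]; first by rewrite yD.
  rewrite !inE !negb_or negb_and negbK => /andP[/andP[_ /orP[/eqP->|->]] //].
  by rewrite (negbTE xB).
- by rewrite /= bB'.
- by case.
Qed.

End MatroidBases.

(** * Refutation by unit propagation *)

Section UnitPropagation.
(* The equality test is a parameter so that a fast one can be supplied. *)
Variables (V : Type) (eqv : V -> V -> bool).
Hypothesis eqv_eq : forall x y, eqv x y -> x = y.

Definition clause := seq (V * bool).
Definition cnf := seq clause.

(** [None] marks a clause that has become true and is dropped; an empty clause is a
    contradiction. *)
Fixpoint assign_clause (x : V) (b : bool) (c : clause) : option clause :=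
  match c with
  | [::] => Some [::]
  | (y, b') :: c' =>
      if eqv x y then if eqb b b' then None else assign_clause x b c'
      else if assign_clause x b c' is Some r then Some ((y, b') :: r) else None
  end.

Fixpoint assign (x : V) (b : bool) (F : cnf) : cnf :=
  match F with
  | [::] => [::]
  | c :: F' =>
      if assign_clause x b c is Some r then r :: assign x b F' else assign x b F'
  end.

(* None signals an empty clause. *)
Fixpoint find_unit (F : cnf) (u : option (V * bool)) : option (option (V * bool)) :=
  match F with
  | [::] => Some u
  | [::] :: _ => None
  | [:: l] :: F' => find_unit F' (Some l)
  | _ :: F' => find_unit F' u
  end.

Fixpoint propagate (fuel : nat) (F : cnf) : option cnf :=
  if fuel is n.+1 then
    match find_unit F None with
    | None => None
    | Some None => Some F
    | Some (Some (x, b)) => propagate n (assign x b F)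
    end
  else Some F.

Definition occurs (x : V) (F : cnf) : bool := has (has (fun l => eqv l.1 x)) F.

(** Running out of fuel only leaves the formula less simplified, so soundness holds for every
    [fuel]. *)
Fixpoint refute (fuel : nat) (splits : seq V) (F : cnf) : bool :=
  if propagate fuel F is Some F' then
    if splits is x :: s then
      if occurs x F' then
        if refute fuel s (assign x true F')
        then refute fuel s (assign x false F') else false
      else refute fuel s F'
    else false
  else true.

Variable P : V -> bool.

Definition sat_clause (c : clause) : bool := has (fun l => P l.1 == l.2) c.
Definition sat (F : cnf) : bool := all sat_clause F.

Lemma assign_clause_sat x c : sat_clause c ->
  if assign_clause x (P x) c is Some r then sat_clause r else true.
Proof.
elim: c => [|[y b] c IH] //=; case: ifP => [/eqv_eq <-|_].
  by rewrite -[eqb _ _]/(P x == b) {2}/sat_clause /=; case: (P x == b).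
case: (assign_clause _ _ _) IH => [r|//]; rewrite /sat_clause /= => IH.
by case/orP => [->|/IH ->] //; rewrite orbT.
Qed.

Lemma assign_sat x F : sat F -> sat (assign x (P x) F).
Proof.
elim: F => [|c F IH] //= /andP[/assign_clause_sat - /(_ x) hc /IH hF].
by case: (assign_clause _ _ _) hc => //= r ->.
Qed.

Lemma find_unit_sat F u : sat F -> (if u is Some l then P l.1 == l.2 else true) ->
  if find_unit F u is Some u' then
    if u' is Some l then P l.1 == l.2 else true
  else false.
Proof.
elim: F u => [|[|l [|m c]] F IH] u //= /andP[h /IH hF] hu; apply: hF => //.
by move: h; rewrite /sat_clause /= orbF.
Qed.

Lemma propagate_sat n F : sat F ->
  if propagate n F is Some F' then sat F' else false.
Proof.
elim: n F => [|n IH] F //= sF.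
have := find_unit_sat (u := None) sF isT.
case: (find_unit F None) => [[[x b]|]|] //= /eqP <-.
exact/IH/assign_sat.
Qed.

Lemma refute_sound n splits F : refute n splits F -> ~~ sat F.
Proof.
elim: splits F => [|x s IH] F /=; have [sF|//] := boolP (sat F);
  have := propagate_sat n sF; case: (propagate n F) => [F'|] //= sF'.
case: ifP => _; last by move=> /IH; rewrite sF'.
case: ifP => // /IH ht /IH hf; have := assign_sat x sF'.
by case: (P x) => [/(negP ht)|/(negP hf)].
Qed.

End UnitPropagation.

(** * Interchangeable orderings of length four *)

Fixpoint eqbits (s t : bitseq) : bool :=
  match s, t with
  | [::], [::] => true
  | true :: s', true :: t' => eqbits s' t'
  | false :: s', false :: t' => eqbits s' t'
  | _, _ => false
  end.

Lemma eqbits_eq s t : eqbits s t -> s = t.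
Proof. by elim: s t => [|[] s IH] [|[] t] //= /IH ->. Qed.

(* Bit k < 4 of a code stands for a_(k+1) and bit 4 + k for b_(k+1). *)
Definition code (L : seq nat) : bitseq := [seq k \in L | k <- iota 0 8].

Definition four_codes : seq bitseq :=
  [seq s <- iter 8 (fun r => [seq b :: s | b <- [:: true; false], s <- r]) [:: [::]]
   | count id s == 4].

Definition diff_code (c d : bitseq) : seq nat :=
  [seq k <- iota 0 8 | nth false c k && ~~ nth false d k].

Definition swap_code (x y : nat) (c : bitseq) : bitseq :=
  set_nth false (set_nth false c x false) y true.

Definition exchange_clause (c d : bitseq) (x : nat) : clause bitseq :=
  (c, false) :: (d, false) :: [seq (swap_code x y c, true) | y <- diff_code d c].

(* Exchanges between codes at distance two are enough for the refutation. *)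
Definition exchange_clauses : cnf bitseq :=
  flatten [seq [seq exchange_clause c d x | x <- diff_code c d]
          | c <- four_codes, d <- [seq d <- four_codes | size (diff_code c d) == 2]].

Definition interchange_code (p q : seq nat) (i j : nat) : bitseq :=
  code [seq if i <= l < j then nth 0 p l else 4 + nth 0 q l | l <- iota 0 4].

Definition intervals : seq (nat * nat) := [seq (i, j) | j <- iota 0 5, i <- iota 0 j.+1].

Definition no_interchange_clauses : cnf bitseq :=
  [seq [seq (interchange_code p q ij.1 ij.2, false) | ij <- intervals]
  | p <- permutations (iota 0 4), q <- permutations (iota 0 4)].

(* A, B, and the bases provided by symmetric_exchange_chain: two steps of the chain
   from A to B, and all B - b_i + a_i. *)
Definition chain_codes : seq bitseq := map code
  [:: [:: 0; 1; 2; 3]; [:: 4; 5; 6; 7]; [:: 0; 1; 6; 7]; [:: 0; 1; 2; 7];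
      [:: 0; 5; 6; 7]; [:: 4; 1; 6; 7]; [:: 4; 5; 2; 7]; [:: 4; 5; 6; 3]].

Definition rank4_cnf : cnf bitseq :=
  [seq [:: (s, true)] | s <- chain_codes] ++ no_interchange_clauses ++ exchange_clauses.

(* Found by local search, minimizing the number of branches. *)
Definition rank4_splits : seq bitseq := map code
  [:: [:: 0; 2; 5; 6]; [:: 0; 2; 5; 7]; [:: 0; 3; 5; 6]; [:: 0; 1; 3; 6];
      [:: 2; 3; 4; 5]; [:: 1; 2; 4; 7]; [:: 1; 5; 6; 7]; [:: 0; 2; 3; 5];
      [:: 3; 4; 6; 7]].

(** There are 70 four-element subsets of eight elements, hence at most 70 variables; each
    propagation round removes one. *)
Lemma rank4_cnf_refuted : refute eqbits 70 rank4_splits rank4_cnf.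
Proof. by vm_cast_no_check (erefl true). Qed.

Section RankFour.
Variables (E : finType) (M : matroid E) (K : {set E}) (e : nat -> E).
Hypothesis e_inj : forall k l, k < 8 -> l < 8 -> e k = e l -> k = l.
Hypothesis eK : forall k, k < 8 -> e k \notin K.

Definition decode (s : bitseq) : {set E} :=
  K :|: [set x in [seq e k | k <- iota 0 8 & nth false s k]].

Lemma decodeP s x :
  reflect (x \in K \/ exists k, [/\ k < 8, nth false s k & x = e k])
          (x \in decode s).
Proof.
rewrite !inE; apply: (iffP orP) => -[xK|]; [by left | | by left |].
  case/mapP=> k; rewrite mem_filter mem_iota => /andP[sk k8] ->.
  by right; exists k.
case=> k [k8 sk ->]; right; apply/mapP; exists k => //.
by rewrite mem_filter sk mem_iota.
Qed.

Lemma mem_decode s k : k < 8 -> (e k \in decode s) = nth false s k.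
Proof.
move=> k8; apply/decodeP/idP => [[eKk|[l [l8 sl /e_inj -> //]]]|sk].
  by case/negP: (eK k8).
by right; exists k.
Qed.

Lemma decode_code L : all (fun k => k < 8) L ->
  decode (code L) = K :|: [set x in [seq e k | k <- L]].
Proof.
move=> /allP L8; apply/setP=> x; apply/decodeP/setUP => -[xK|]; [by left| |by left|].
  case=> k [k8]; rewrite (nth_map 0) ?size_iota // nth_iota // add0n => kL ->.
  by right; rewrite inE map_f.
rewrite inE => /mapP[k kL ->]; right; exists k.
by rewrite (nth_map 0) ?size_iota ?nth_iota ?L8.
Qed.

Lemma decode_swap c x y : x < 8 -> y < 8 -> x != y ->
  decode (swap_code x y c) = e y |: decode c :\ e x.
Proof.
move=> x8 y8 xy; apply/setP=> z; rewrite in_setU1 in_setD1.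
apply/decodeP/orP => [[zK|[k [k8 + ->]]]|[/eqP ->|/andP[zx /decodeP[zK|[k [k8 ck ez]]]]]].
- right; rewrite in_setU zK andbT.
  by apply: contraNneq (eK x8) => <-.
- rewrite !nth_set_nth /=; case: eqVneq => [->|ky]; first by left.
  rewrite nth_set_nth /=; case: eqVneq => // kx ck; right; rewrite mem_decode // ck andbT.
  by apply: contraNneq kx => /e_inj ->.
- by right; exists y; rewrite nth_set_nth /= eqxx.
- by left.
- right; exists k; split=> //; rewrite !nth_set_nth /= !nth_set_nth /=.
  by case: eqVneq => // _; case: eqVneq => // kx; rewrite ez kx eqxx in zx.
Qed.

Definition basis_code (s : bitseq) : bool := decode s \in bases M.

(** The element supplied by the exchange axiom is outside [decode c], hence outside [K], so it is
    some [e k] and its literal is in the clause. *)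
Lemma exchange_clauses_sat : sat basis_code exchange_clauses.
Proof.
apply/allP=> cl /flattenP[l /allpairsPdep[c [d [_ _ ->]]] /mapP[x + ->]].
rewrite mem_filter mem_iota => /andP[/andP[cx dx] /= x8].
rewrite /sat_clause /=; have [bc|//] := boolP (basis_code c).
have [bd /=|//] := boolP (basis_code d).
have [|z] := bases_exchange (x := e x) bc bd; first by rewrite inE !mem_decode // dx.
rewrite inE => /andP[zc zd] b'.
have [k [k8 dk ez]] : exists k, [/\ k < 8, nth false d k & z = e k].
  by case/decodeP: zd zc => // zK; rewrite in_setU zK.
rewrite ez mem_decode // in zc.
apply/hasP; exists (swap_code x k c, true); last first.
  rewrite /= /basis_code decode_swap -?ez ?b' //.
  by apply: contraNneq zc => <-.
by apply: map_f; rewrite mem_filter mem_iota dk zc.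
Qed.

End RankFour.

Lemma rank4_interchange (E : finType) (M : matroid E) (A B : {set E}) :
    A \in bases M -> B \in bases M -> #|A :\: B| = 4 ->
  exists a b : 'I_4 -> E,
    [/\ forall l, a l \in A :\: B, forall l, b l \in B :\: A &
        forall i j, i <= j <= 4 ->
          A :&: B :|: [set if i <= l < j then a l else b l | l : 'I_4] \in bases M].
Proof.
move=> bA bB cAB.
have cBA : #|B :\: A| = 4 by rewrite (card_basesD bB bA).
have us := enum_uniq (A :\: B).
have sAB : {subset enum (A :\: B) <= A :\: B} by move=> z; rewrite mem_enum.
have [t [ts ut tBA allt chain]] := symmetric_exchange_chain bA bB us sAB.
move: ts us sAB allt chain (set_enum (A :\: B)); rewrite -cardE cAB.
move: (cardE (A :\: B)); rewrite cAB.
(* Named backwards: the chain swaps [a4] for [y4], then [a3] for [y3], passing through the codes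
   0,1,2,7 and 0,1,6,7. *)
case: (enum _) => [|a4 [|a3 [|a2 [|a1 []]]]] // _.
case: t ut tBA => [|y4 [|y3 [|y2 [|y1 []]]]] // ut tBA _ us sAB.
move=> /and5P[/= bB4 bB3 bB2 bB1 _] chain eAB.
have eBA : [set x in [:: y4; y3; y2; y1]] = B :\: A.
  apply/eqP; rewrite eqEcard cBA cardsE (card_uniqP ut) leqnn andbT.
  by apply/subsetP=> z; rewrite inE => /tBA.
pose es := [:: a1; a2; a3; a4; y1; y2; y3; y4].
pose e k := nth a1 es k.
have a_es k : k < 4 -> e k \in A :\: B.
  by rewrite -eAB inE; case: k => [|[|[|[|]]]] // _; rewrite /e /= !inE eqxx ?orbT.
have b_es k : k < 4 -> e (4 + k) \in B :\: A.
  by rewrite -eBA inE; case: k => [|[|[|[|]]]] // _; rewrite /e /= !inE eqxx ?orbT.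
have ues : uniq es.
  rewrite -[es]/(rev [:: a4; a3; a2; a1] ++ rev [:: y4; y3; y2; y1]).
  rewrite cat_uniq !rev_uniq us ut.
  rewrite andbT; apply/hasPn=> z; rewrite !mem_rev => /tBA; rewrite inE => /andP[zA _].
  by apply: contra zA => /sAB; rewrite inE => /andP[].
have e_inj k l : k < 8 -> l < 8 -> e k = e l -> k = l.
  by move=> k8 l8 /eqP; rewrite nth_uniq // => /eqP.
have eK k : k < 8 -> e k \notin A :&: B.
  move=> k8; have [k4|k4] := ltnP k 4.
    by have := a_es k k4; rewrite !inE => /andP[/negbTE->]; rewrite andbF.
  have := b_es (k - 4); rewrite subnKC // ltn_subLR // k8 => /(_ isT).
  by rewrite !inE => /andP[/negbTE->].
pose P := basis_code M (A :&: B) e.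
have eA : decode (A :&: B) e (code [:: 0; 1; 2; 3]) = A.
  rewrite decode_code // -[RHS](setID A B) -eAB; congr (_ :|: _).
  by apply/setP=> z; rewrite !inE /e /=; do 4!case: (z == _).
have eB : decode (A :&: B) e (code [:: 4; 5; 6; 7]) = B.
  rewrite decode_code // -[RHS](setID B A) -eBA setIC; congr (_ :|: _).
  by apply/setP=> z; rewrite !inE /e /=; do 4!case: (z == _).
pose cA := code [:: 0; 1; 2; 3]; pose cB := code [:: 4; 5; 6; 7].
have chainP : all P chain_codes.
  rewrite -[chain_codes]/[:: cA; cB;
    swap_code 2 6 (swap_code 3 7 cA); swap_code 3 7 cA;
    swap_code 4 0 cB; swap_code 5 1 cB; swap_code 6 2 cB; swap_code 7 3 cB].
  rewrite /= /P /basis_code !decode_swap // eA eB bA bB.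
  by rewrite (chain 2) (chain 1) bB1 bB2 bB3 bB4.
have : ~~ [&& sat P [seq [:: (s, true)] | s <- chain_codes],
            sat P no_interchange_clauses & sat P exchange_clauses].
  by rewrite /sat -!all_cat; exact: (refute_sound eqbits_eq P rank4_cnf_refuted).
rewrite (exchange_clauses_sat M e_inj eK) andbT.
have -> : sat P [seq [:: (s, true)] | s <- chain_codes].
  rewrite /sat all_map; apply: sub_all chainP => s Ps.
  by rewrite /= /sat_clause /= Ps.
rewrite andTb.
(* The other clauses hold, so a no-interchange clause fails: for its [p] and [q] every interval
   gives a basis. *)
case/allPn=> cl /allpairsPdep[p [q [pp qq ->]]] /hasPn noint.
have mem4 (s : seq nat) l : s \in permutations (iota 0 4) -> l < 4 -> nth 0 s l < 4.
  rewrite mem_permutations => ps l4; have := perm_mem ps (nth 0 s l).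
  by rewrite mem_nth ?(perm_size ps) // mem_iota => /esym.
exists (fun l => e (nth 0 p l)), (fun l => e (4 + nth 0 q l)).
split=> [l|l|i j ij]; [exact/a_es/mem4 | exact/b_es/mem4 |].
have ijP : (i, j) \in intervals.
  apply/allpairsPdep; exists j, i; rewrite !mem_iota add0n.
  by case/andP: ij => ij j4; rewrite !ltnS ij j4.
have := noint _ (map_f (fun ij => (interchange_code p q ij.1 ij.2, false)) ijP).
rewrite eqbF_neg negbK /P /basis_code decode_code.
  rewrite (_ : [set x in _] =
    [set if i <= l < j then e (nth 0 p l) else e (4 + nth 0 q l) | l : 'I_4]) //.
  apply/setP=> z; rewrite inE -map_comp; apply/mapP/imsetP => [[l]|[l _ ->]].
    by rewrite mem_iota => l4 ->; exists (Ordinal l4) => //=; case: ifP.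
  by exists (l : nat); [rewrite mem_iota ltn_ord | rewrite [RHS]fun_if].
apply/allP=> k /mapP[l]; rewrite mem_iota => l4 ->; case: ifP => _.
  exact: ltn_trans (mem4 _ _ pp l4) _.
by rewrite -[8]/(4 + 4) ltn_add2l mem4.
Qed.

Local Open Scope ring_scope.

(** * Coloured pairs *)

Lemma addr_neq_self (G : zmodType) (x d : G) : d <> 0 -> x + d <> x.
Proof. by move=> d0 /(canRL (addKr _)); rewrite addNr. Qed.

Ltac cancel_right :=
  repeat match goal with
  | h : @GRing.add _ _ ?d = @GRing.add _ _ ?d |- _ => apply addIr in h
  | h : ?u = ?u |- _ => clear h
  | _ => progress subst
  end.

(* Colouring the pair i < j red if x_j = x_i + d and blue if y_j = y_i + c leaves
   no monochromatic triangle, so both colours are 5-cycles; at most one of them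
   can be the monotone one 0,1,2,3,4, and any other one telescopes to d = 0 or
   c = 0. *)
Lemma five_points (G H : zmodType) (d : G) (c : H) (x0 x1 x2 x3 x4 : G)
    (y0 y1 y2 y3 y4 : H) :
  d <> 0 -> c <> 0 ->
  x1 = x0 + d \/ y1 = y0 + c -> x2 = x0 + d \/ y2 = y0 + c ->
  x2 = x1 + d \/ y2 = y1 + c -> x3 = x0 + d \/ y3 = y0 + c ->
  x3 = x1 + d \/ y3 = y1 + c -> x3 = x2 + d \/ y3 = y2 + c ->
  x4 = x0 + d \/ y4 = y0 + c -> x4 = x1 + d \/ y4 = y1 + c ->
  x4 = x2 + d \/ y4 = y2 + c -> x4 = x3 + d \/ y4 = y3 + c -> False.
Proof.
move=> d0 c0.
do 10!(case=> ?; cancel_right;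
  try by [match goal with
  | h : ?x + ?d = ?x |- _ => apply: addr_neq_self h
  | h : ?x = ?x + ?d |- _ => apply: addr_neq_self (esym h)
  end]).
(* The surviving colourings force twice and three times the same nonzero element to vanish. *)
all: match goal with
  h : ?x = ?x + ?d + ?d, h' : ?x = ?x + ?d + ?d + ?d |- _ =>
    by rewrite -h in h'; apply: addr_neq_self (esym h')
  end.
Qed.

(** The Ramsey recursion for triangles, counting vertices; its value 5 at two colours is lowered to
    4 by [five_points]. *)
Fixpoint colour_bound (k : nat) : nat :=
  match k with
  | 0 => 1
  | 2 => 4
  | k'.+1 => k'.+1 * colour_bound k' + 1
  end%N.

Section ColouredPairs.
Variables (I : finType) (Gamma : I -> zmodType) (d : forall t, Gamma t).
Variables (s : forall t, nat -> Gamma t).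
Hypothesis d_neq0 : forall t, d t <> 0.

Definition coloured (T : {set I}) : rel nat :=
  fun i j => [exists t in T, s t j == s t i + d t].

(** Split [V] by the colours of its pairs with [i]. On the part of colour [t] the value of [s t] is
    constant, so a pair of colour [t] inside it would give [d t = 0]. *)
Lemma coloured_size_step (T : {set I}) m i V :
    (forall t U, t \in T -> pairwise (coloured (T :\ t)) U -> size U <= m)%N ->
    pairwise (coloured T) (i :: V) ->
  (size V <= #|T| * m)%N.
Proof.
move=> IH /= /andP[/allP iV pV].
have -> : size V = count (fun j => coloured T i j) V.
  by apply/esym/eqP; rewrite -all_count; apply/allP.
apply: (@leq_trans (\sum_(t in T) count (fun j => (s t j == s t i + d t)%R) V)%N).
  elim: V {iV pV} => [|j V IHV] //=; rewrite big_split /= leq_add //.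
  have [/exists_inP[t tT sj]|//] := boolP (coloured T i j).
  by rewrite (bigD1 t) //= sj leq_addr.
rewrite -sum_nat_const; apply: leq_sum => t tT.
rewrite -size_filter; apply: (IH t) => //.
set U := filter _ _.
have pU : pairwise (coloured T) U by apply: subseq_pairwise pV; exact: filter_subseq.
have aU : all (fun j => s t j == s t i + d t) U by exact: filter_all.
apply: (sub_in_pairwise (P := [pred j | s t j == s t i + d t])) pU => //.
move=> j l /eqP sj /eqP sl /exists_inP[u uT su]; apply/exists_inP; exists u => //.
rewrite in_setD1 uT andbT; apply/eqP=> ut; move: su; rewrite ut sj sl => /eqP /esym.
exact: addr_neq_self.
Qed.

Lemma coloured_size (T : {set I}) V :
  pairwise (coloured T) V -> (size V <= colour_bound #|T|)%N.
Proof.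
move: {2}#|T| (erefl #|T|) => n; elim: n T V => [|n IH] T [|i V] //= cT.
  case: V => [|j V] //; first by rewrite cT.
  by move=> /andP[/andP[/exists_inP[t]]]; rewrite (cards0_eq cT) inE.
have step := @coloured_size_step T (colour_bound n) i V.
move=> pV; have {step} : (size V <= n.+1 * colour_bound n)%N.
  rewrite -cT; apply: step pV => t U tT; move: cT.
  rewrite (cardsD1 t) tT add1n => -[cT] pU.
  by have := IH _ _ cT pU; rewrite cT.
rewrite cT; case: n cT IH => [|[|n]] cT IH sV /=; last by rewrite addn1.
  by rewrite addn1.
(* The recursion leaves five vertices as the only case to exclude. *)
have /cards2P[t [u [tu eT]]] : #|T| == 2 by rewrite cT.
have edge j l : coloured T j l -> s t l = s t j + d t \/ s u l = s u j + d u.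
  by case/exists_inP=> v; rewrite eT !inE => /orP[]/eqP-> /eqP; [left|right].
case: V pV sV => [|j [|k [|l [|m [|n V]]]]] //= /and5P[].
move=> /and5P[ij ik il im _] /and4P[jk jl jm _] /and3P[kl km _] /andP[lm _] _ _.
by case: (@five_points _ _ (d t) (d u) (s t i) (s t j) (s t k) (s t l) (s t m)
  (s u i) (s u j) (s u k) (s u l) (s u m)) => //; exact: edge.
Qed.

End ColouredPairs.

(** * Comparison of the colour bound with Euler's number *)

Lemma series_exp_coeff_le (R : realType) (x : R) n :
  0 <= x -> series (exp_coeff x) n <= expR x.
Proof.
move=> x0; apply: (nondecreasing_cvgn_le _ (is_cvg_series_exp_coeff x)).
apply/nondecreasing_seqP => m; rewrite seriesSr lerDl.
by rewrite /exp_coeff /= divr_ge0 ?exprn_ge0.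
Qed.

(** Divided by the factorial, the recursion adds [1 / k!] at each step, starting from 4/2! = (1 + 1
    + 1/2) - 1/2. *)
Lemma colour_bound_series (R : realType) k :
  (colour_bound k.+2)%:R
    = (series (exp_coeff (1 : R)) k.+3 - 1 / 2) * k.+2`!%:R :> R.
Proof.
elim: k => [|k IH].
  rewrite /series /= !big_nat_recr //= big_nil /exp_coeff /= !expr1n !factS fact0.
  by field.
rewrite seriesSr [colour_bound _]/= -/(colour_bound k.+2) natrD natrM IH.
rewrite /exp_coeff /= expr1n.
rewrite [in RHS]factS natrM.
have f0 : k.+2`!%:R != 0 :> R by rewrite pnatr_eq0 -lt0n fact_gt0.
have k0 : k.+3%:R != 0 :> R by rewrite pnatr_eq0.
by move: f0 k0; move: (k.+2`!%:R) (k.+3%:R) => u v u0 v0; field; rewrite u0 v0.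
Qed.

Lemma colour_bound_le_expR (R : realType) k :
  (colour_bound k)%:R <= (expR 1 - 1 / 2) * k`!%:R :> R.
Proof.
case: k => [|[|k]]; last first.
  by rewrite colour_bound_series ler_wpM2r // lerB // series_exp_coeff_le.
(* For at most one colour, three terms of the series suffice: they give e at least 5/2. *)
- have := @series_exp_coeff_le R 1 3 ler01.
  rewrite /series /= !big_nat_recr //= big_nil /exp_coeff /= !expr1n !factS fact0 /=.
  by lra.
have := @series_exp_coeff_le R 1 3 ler01.
rewrite /series /= !big_nat_recr //= big_nil /exp_coeff /= !expr1n !factS fact0 /=.
by lra.
Qed.

(** * Interval interchanges *)

(** The cardinality forces [c] to be injective with image disjoint from [K]. *)
Lemma sum_setU_imset (E : finType) (G : zmodType) (F : E -> G) (K : {set E}) n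
    (c : 'I_n -> E) :
    #|K :|: [set c l | l : 'I_n]| = (#|K| + n)%N ->
  \sum_(x in K :|: [set c l | l : 'I_n]) F x = \sum_(x in K) F x + \sum_l F (c l).
Proof.
set S := [set c l | l : 'I_n] => cKS.
have le_S : (#|S| <= n)%N by rewrite -[leqRHS]card_ord leq_imset_card.
have := cardsUI K S; rewrite cKS -addnA => /addnI eqn.
have cS : #|S| = n by apply/eqP; rewrite eqn_leq le_S -eqn leq_addr.
have dKS : [disjoint K & S].
  rewrite -setI_eq0 -cards_eq0; move/eqP: eqn.
  by rewrite cS -{2}[n]addn0 eqn_add2l.
rewrite (eq_bigl (fun x => x \in [predU K & S])) => [|x]; last by rewrite !inE.
rewrite bigU //= big_imset //; apply/imset_injP.
by rewrite -/S cS card_ord.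
Qed.

Definition avoids (E I : finType) (Gamma : I -> zmodType)
    (psi : forall t, E -> Gamma t) (f : forall t, Gamma t) (C : {set E}) : bool :=
  [forall t, \sum_(x in C) psi t x != f t].

Section Interchange.
Variables (E I : finType) (M : matroid E) (Gamma : I -> zmodType).
Variables (psi : forall t, E -> Gamma t) (f : forall t, Gamma t).
Variables (A B K : {set E}) (n : nat) (a b : 'I_n -> E).

(** Half-open intervals turn exchanges into pairs of points of 0, ..., n. Part (i) takes [K] empty
    and allows positions with [a l = b l]; part (ii) puts the common elements into [K]. *)
Let C (i j : nat) : {set E} :=
  K :|: [set if (i <= l < j)%N then a l else b l | l : 'I_n].

Hypothesis bB : B \in bases M.
Hypothesis eB : B = K :|: [set b l | l : 'I_n].
Hypothesis cB : #|B| = (#|K| + n)%N.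
Hypothesis bC : forall i j, (i < j <= n)%N -> C i j \in bases M.
Hypothesis aA : forall l, a l \in A.
Hypothesis aB : forall l, a l \in B -> a l = b l.
Hypothesis bA : forall l, b l \in A -> a l = b l.
Hypothesis vB : avoids psi f B.
Hypothesis minB : forall D, D \in bases M -> avoids psi f D ->
  (#|A :\: B| <= #|A :\: D|)%N.

(** No element of [A :&: B] is lost, since [b l] is in [A] only when [a l = b l]; and [a m] is
    gained. *)
Lemma interchange_closer i (m : 'I_n) : (i <= m)%N -> a m != b m ->
  (#|A :\: C i m.+1| < #|A :\: B|)%N.
Proof.
move=> im ab; apply: proper_card; apply/properP; split.
  apply/subsetP=> x; rewrite !inE negb_or => /andP[/andP[xK xC] xA]; rewrite xA andbT.
  rewrite eB inE negb_or xK; apply: contra xC => /imsetP[l _ xb].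
  by apply/imsetP; exists l => //; rewrite bA -?xb //; case: ifP.
exists (a m); first by rewrite inE aA andbT; apply: contraNN ab => /aB ->.
rewrite !inE aA andbT negbK; apply/orP; right.
by apply/imsetP; exists m => //; rewrite im ltnSn.
Qed.

(** The vertices are 0 and [l.+1] for each [l] with [a l != b l], so that every interval between two
    vertices ends in a proper exchange. *)
Lemma interchange_bound : (#|[set l | a l != b l]| < colour_bound #|I|)%N.
Proof.
pose D t l := psi t (a l) - psi t (b l).
pose s t j := \sum_(l < n | (l < j)%N) D t l.
pose d t := f t - \sum_(x in B) psi t x.
have d0 t : d t <> 0 by move/eqP; rewrite subr_eq0 eq_sym; apply/negP/(forallP vB).
have col i (m : 'I_n) : (i <= m)%N -> a m != b m -> coloured d s setT i m.+1.
  move=> im ab; have ijn : (i < m.+1 <= n)%N by rewrite ltnS im ltn_ord.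
  have /forallPn[t] : ~~ avoids psi f (C i m.+1).
    by apply: contraL (interchange_closer im ab) => vC; rewrite -leqNgt minB ?bC.
  rewrite negbK => /eqP sC; apply/exists_inP; exists t; rewrite ?inE //.
  rewrite /d -sC eB !sum_setU_imset -?eB ?(card_bases (bC ijn) bB) //.
  rewrite opprD addrACA subrr add0r -sumrB /s (big_mkcond (fun l : 'I_n => l < i)%N).
  rewrite (big_mkcond (fun l : 'I_n => l < _)%N) -big_split /=; apply/eqP.
  apply: eq_bigr => l _; have [li|il] /= := ltnP l i.
    by rewrite ltnS (ltnW (leq_trans li im)) subrr addr0.
  by rewrite ltnS add0r; case: ifP => //; rewrite subrr.
pose W := [seq l <- enum 'I_n | a l != b l].
have sW : size W = #|[set l | a l != b l]|.
  by rewrite cardsE cardE /W enumT.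
have ltW : pairwise (fun l m : 'I_n => l < m)%N W.
  apply: subseq_pairwise (filter_subseq _ _) _.
  rewrite -[pairwise _ _]/(pairwise (relpre val ltn) _) -pairwise_map val_enum_ord.
  by rewrite -sorted_pairwise ?iota_ltn_sorted //; apply: ltn_trans.
have := @coloured_size _ _ d s d0 setT (0%N :: [seq (val l).+1 | l <- W]).
rewrite cardsT /= size_map sW; apply.
have aW : all (fun l => a l != b l) W by exact: filter_all.
rewrite all_map pairwise_map; apply/andP; split.
  by apply: sub_all aW => l abl /=; apply: col.
apply: (sub_in_pairwise (P := fun l => a l != b l)) ltW => //.
by move=> l m _ abm lm; apply: col.
Qed.

End Interchange.

(** * Avoiding bases closest to [A] *)

Section ClosestAvoidingBasis.
Variables (E I : finType) (M : matroid E) (Gamma : I -> zmodType).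
Variables (psi : forall t, E -> Gamma t) (f : forall t, Gamma t).
Variables (A B : {set E}).
Hypothesis bA : A \in bases M.
Hypothesis bB : B \in bases M.
Hypothesis vB : avoids psi f B.
Hypothesis minB : forall D, D \in bases M -> avoids psi f D ->
  (#|A :\: B| <= #|A :\: D|)%N.

Lemma closest_SIBO : SIBO M -> (#|A :\: B| < colour_bound #|I|)%N.
Proof.
move=> /(_ A B bA bB)[a [b [[_ eA] [_ eB] bases_ab]]].
have imC (i j : nat) : (i < j <= rank M)%N ->
    [set if (i <= l < j)%N then a l else b l | l : 'I_(rank M)] \in bases M.
  case/andP=> ij jr; have j0 : (0 < j)%N by exact: leq_ltn_trans ij.
  have j'r : (j.-1 < rank M)%N by rewrite prednK.
  have := bases_ab (Ordinal (leq_trans ij jr)) (Ordinal j'r).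
  rewrite /= -ltnS prednK // => /(_ ij); rewrite (_ : _ :|: _ =
    [set if (i <= l < j)%N then a l else b l | l : 'I_(rank M)]) //.
  apply/setP=> x; rewrite !inE; apply/idP/imsetP => [|[l _ ->]].
    case/orP=> [/orP[]|] /imsetP[l]; rewrite !inE => hl ->; exists l => //=.
    - by rewrite leqNgt hl.
    - by move: hl; rewrite -[(_ <= j.-1)%N]ltnS prednK // => ->.
    - by rewrite (ltnNge l) hl andbF.
  have [li|il] := ltnP l i; first by rewrite imset_f // inE li.
  have [lj|jl] := ltnP l j.
    by rewrite imset_f ?orbT // inE /= il -ltnS prednK.
  by apply/orP; right; apply: imset_f; rewrite inE.
have card_im c : [set c l | l : 'I_(rank M)] \in bases M -> injective c.
  move=> bc; apply: in2T; apply/imset_injP.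
  by rewrite (card_basis_rank bc) card_ord.
(* If [a l = b m] with [m] different from [l], exchanging position [l] alone would repeat this
   element, leaving too few for a basis. *)
have aB l : a l \in B -> a l = b l.
  rewrite -eB => /imsetP[m _ alm].
  have ll : (l < l.+1 <= rank M)%N by rewrite ltnSn ltn_ord.
  have := card_im _ (imC _ _ ll) l m; rewrite leqnn ltnSn /= ltnS -eqn_leq.
  have [lm|lm] := eqVneq l m; first by rewrite alm lm.
  rewrite (inj_eq val_inj) (negbTE lm).
  by move=> /(_ alm)/eqP; rewrite (negbTE lm).
have bI : injective b by apply: card_im; rewrite eB.
have bA' l : b l \in A -> a l = b l.
  rewrite -eA => /imsetP[m _ blm].
  have /aB abm : a m \in B by rewrite -blm -eB imset_f.
  by rewrite (bI l m) // blm.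
have := @interchange_bound _ _ M _ psi f A B set0 (rank M) a b bB.
rewrite set0U eB cards0 => /(_ erefl (card_basis_rank bB)) bound.
apply: leq_ltn_trans (bound _ _ _ _ vB minB) => //; last 1 first.
- by move=> l; rewrite -eA imset_f.
- apply: leq_trans (leq_imset_card a _); apply: subset_leq_card.
  apply/subsetP=> x; rewrite inE -eA => /andP[xB /imsetP[l _ xa]].
  rewrite xa imset_f // inE; apply: contraNneq xB => abl.
  by rewrite xa abl -eB imset_f.
by move=> i j ij; rewrite set0U imC.
Qed.

Lemma closest_two_colours : #|I| = 2 -> (#|A :\: B| <= 3)%N.
Proof.
move=> cI; rewrite leqNgt; apply/negP => /card_geqP[s [us ss sAB]].
(* Keep [A :&: B] and four elements of [A :\: B], and fill up from [B]. *)
have [|A' [bA' sYA' sA'Y]] := @basis_extension _ M ([set x in s] :|: A :&: B) A B bA bB.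
  rewrite subUset subsetIl andbT; apply/subsetP=> x; rewrite inE => /sAB.
  by rewrite inE => /andP[].
have eA'B : A' :\: B = [set x in s].
  apply/setP=> x; rewrite in_setD; apply/andP/idP => [[xB /(subsetP sA'Y)]|xs].
    by rewrite !in_setU in_setI (negbTE xB) andbF !orbF.
  split; last by rewrite (subsetP sYA') // in_setU xs.
  by move: xs; rewrite inE => /sAB; rewrite inE => /andP[].
have cA'B : #|A' :\: B| = 4 by rewrite eA'B cardsE (card_uniqP us).
have [a [b [aA'B bBA' bC]]] := rank4_interchange bA' bB cA'B.
have aAB l : a l \in A :\: B.
  by apply: sAB; have := aA'B l; rewrite eA'B inE.
(* Here [A :&: B] being inside [A'] matters: [b l] is in [B] but not in [A']. *)
have bnA l : b l \notin A.
  have := bBA' l; rewrite inE => /andP[+ bl]; apply: contra => blA.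
  by rewrite (subsetP sYA') // in_setU in_setI blA bl orbT.
have eB : B = A' :&: B :|: [set b l | l : 'I_4].
  have bB' : A' :&: B :|: [set b l | l : 'I_4] \in bases M.
    by have := bC 0%N 0%N isT; rewrite (eq_imset (g := b)).
  apply/esym/eqP; rewrite eqEcard (card_bases bB bB') leqnn andbT subUset subsetIr.
  by apply/subsetP=> x /imsetP[l _ ->]; have := bBA' l; rewrite inE => /andP[].
have cB : #|B| = (#|A' :&: B| + 4)%N.
  by rewrite -(cardsID A' B) (card_basesD bB bA') cA'B setIC.
have bC' i j : (i < j <= 4)%N ->
    A' :&: B :|: [set if (i <= l < j)%N then a l else b l | l : 'I_4] \in bases M.
  by move=> /andP[ij j4]; rewrite bC // ltnW.
have aA l : a l \in A by have := aAB l; rewrite inE => /andP[].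
have anB l : a l \notin B by have := aAB l; rewrite inE => /andP[].
have aB l : a l \in B -> a l = b l by rewrite (negbTE (anB l)).
have bA'' l : b l \in A -> a l = b l by rewrite (negbTE (bnA l)).
have := interchange_bound bB eB cB bC' aA aB bA'' vB minB.
(* All four exchanges are proper, so the bound reads 4 < [colour_bound 2] = 4. *)
suff -> : [set l | a l != b l] = setT by rewrite cI cardsT card_ord.
by apply/setP=> l; rewrite !inE; apply: contraNneq (bnA l) => <-.
Qed.

End ClosestAvoidingBasis.

Theorem theorem5p3 (R : realType) (E : finType) (M : matroid E) (A : {set E})
    (k : nat) (Gamma : 'I_k -> zmodType) (psi : forall t : 'I_k, E -> Gamma t)
    (f : forall t : 'I_k, Gamma t)
    (hA : A \in bases M)
    (hB' : exists B' : {set E},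
       B' \in bases M /\ forall t : 'I_k, \sum_(x in B') psi t x <> f t) :
  (SIBO M ->
     exists B : {set E},
       [/\ B \in bases M,
           forall t : 'I_k, \sum_(x in B) psi t x <> f t &
           (#|A :\: B|%:Z <= Num.floor ((expR 1 - 1 / 2) * k`!%:R : R) - 1)])
  /\
  (k = 2%N ->
     exists B : {set E},
       [/\ B \in bases M,
           forall t : 'I_k, \sum_(x in B) psi t x <> f t &
           (#|A :\: B| <= 3)%N]).
Proof.
have avoidsP (C : {set E}) :
    reflect (forall t, \sum_(x in C) psi t x <> f t) (avoids psi f C).
  by apply: (iffP forallP) => h t; apply/eqP/h.
case: hB' => B' [bB' /avoidsP vB'].
pose P (C : {set E}) := (C \in bases M) && avoids psi f C.
have PB' : P B' by rewrite /P bB' vB'.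
case: (arg_minnP (fun C => #|A :\: C|) PB') => B /andP[bB vB] minP.
have minB (D : {set E}) : D \in bases M -> avoids psi f D -> (#|A :\: B| <= #|A :\: D|)%N.
  by move=> bD vD; apply: minP; rewrite /P bD vD.
split=> [sibo|k2]; exists B; split=> //; try exact/avoidsP.
  have := closest_SIBO hA bB vB minB sibo; rewrite card_ord => lt_bound.
  rewrite lerBrDr floor_ge_int.
  apply: le_trans (colour_bound_le_expR R k).
  by rewrite -PoszD -pmulrn ler_nat addn1.
by apply: closest_two_colours hA bB vB minB _; rewrite card_ord.
Qed.
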